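(* Let $L=(L,\wedge,\vee,{}',0,1,\exists)$ be a monadic ortholattice, let $\mathcal{F}(L)$ be its set of proper non-empty filters, with $x\perp y$ iff there is a non-zero $a\in L$ with $a\in x$ and $a'\in y$. Define a binary relation $R$ on $\mathcal{F}(L)$ by $x\,R\,y$ iff $\exists[x]\subseteq y$, where $\exists[x]=\{\exists a:a\in x\}$. Then $X=(\mathcal{F}(L),\perp,R)$ is a monadic orthoframe, and the map $h:L\to\mathcal{B}(X)$, $h(a)=\{x\in\mathcal{F}(L):a\in x\}$, is the canonical completion (canonical extension) of the monadic ortholattice $L$, where $\mathcal{B}(X)$ carries the orthocomplementation $A\mapsto A^\perp$ and the quantifier $A\mapsto R[A]^{\perp\perp}$.
   Context: An ortholattice is a bounded lattice with an order-inverting complementation $'$ of period two. A monadic ortholattice is an ortholattice with a quantifier $\exists$, i.e. a closure operator (order preserving, $a\le\exists a$, $\exists\exists a=\exists a$) such that the orthocomplement of each closed element is closed. An orthoframe is a set $X$ with an irreflexive symmetric relation $\perp$. For $S\subseteq X$, $S^\perp=\{y\in X:x\perp y\text{ for all }x\in S\}$; $S$ is bi-orthogonally closed if $S=S^{\perp\perp}$. The set $\mathcal{B}(X)$ of bi-orthogonally closed subsets, ordered by inclusion, is a complete ortholattice with orthocomplement $S\mapsto S^\perp$, meets given by intersection, and joins given by the bi-orthogonal of the union. For a binary relation $R$ on $X$ and $A\subseteq X$, $R[A]=\{y\in X:x\,R\,y\text{ for some }x\in A\}$. A monadic orthoframe is $(X,\perp,R)$ with $(X,\perp)$ an orthoframe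 and $R$ reflexive, transitive, with $R[R[\{x\}]^\perp]\subseteq R[\{x\}]^\perp$ for all $x\in X$; it is known that then $\mathcal{B}(X)$ is a monadic ortholattice under the quantifier $\exists A=R[A]^{\perp\perp}$. For a bounded lattice $L$, its canonical completion is a pair $(e,C)$ where $C$ is a complete lattice and $e:L\to C$ is a bounded lattice embedding that is dense (each element of $C$ is both a join of meets and a meet of joins of elements of the image of $L$) and compact (if $S,T\subseteq L$ and $\bigwedge e[S]\le\bigvee e[T]$, then $\bigwedge e[S']\le\bigvee e[T']$ for some finite $S'\subseteq S$ and $T'\subseteq T$). It is unique up to isomorphism. An element of $C$ is closed if it is a meet of elements of the image of $L$; $\mathcal{K}$ is the set of closed elements. For a monadic ortholattice $L$, the canonical completion is $C$ equipped with the extended operations $$x^{'^\sigma}=\bigwedge\{\bigvee\{e(a'):k\le e(a)\}:k\le x,\ k\in\mathcal{K}\},\qquad \exists^\sigma x=\bigvee\{\bigwedge\{e(\exists a):k\le e(a)\}:k\le x,\ k\in\mathcal{K}\}.$$ *)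

(* Defs.v *)
From HB Require Import structures.
From mathcomp Require Import all_boot all_order.
From mathcomp Require Import boolp classical_sets cardinality.

Set Implicit Arguments.
Unset Strict Implicit.
Unset Printing Implicit Defensive.

Import Order.TTheory.
Local Open Scope classical_set_scope.
Local Open Scope order_scope.

HB.mixin Record TBLattice_isOrtholattice (d : Order.disp_t) T
    of Order.TBLattice d T := {
  ocompl : T -> T;
  ocomplI : forall a : T, Order.meet a (ocompl a) = \bot;
  ocomplU : forall a : T, Order.join a (ocompl a) = \top;
  ocompl_le : forall a b : T, a <= b -> ocompl b <= ocompl a;
  ocomplK : forall a : T, ocompl (ocompl a) = a
}.

#[short(type="ortholatticeType")]
HB.structure Definition Ortholattice d :=
  { T of Order.TBLattice d T & TBLattice_isOrtholattice d T }.

(* An element c is closed for the quantifier when exq c = c. *)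
HB.mixin Record Ortholattice_isMonadic (d : Order.disp_t) T
    of Ortholattice d T := {
  exq : T -> T;
  exq_le : forall a b : T, a <= b -> exq a <= exq b;
  exq_ge : forall a : T, a <= exq a;
  exqK : forall a : T, exq (exq a) = exq a;
  exq_ocompl : forall c : T, exq c = c -> exq (ocompl c) = ocompl c
}.

#[short(type="monadicOrtholatticeType")]
HB.structure Definition MonadicOrtholattice d :=
  { T of Ortholattice d T & Ortholattice_isMonadic d T }.

HB.mixin Record TBLattice_isComplete (d : Order.disp_t) T
    of Order.TBLattice d T := {
  bigmeet : set T -> T;
  bigjoin : set T -> T;
  bigmeetP : forall A : set T, infimums A (bigmeet A);
  bigjoinP : forall A : set T, supremums A (bigjoin A)
}.

#[short(type="completeLatticeType")]
HB.structure Definition CompleteLattice d :=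
  { T of Order.TBLattice d T & TBLattice_isComplete d T }.

#[short(type="completeOrtholatticeType")]
HB.structure Definition CompleteOrtholattice d :=
  { T of Ortholattice d T & TBLattice_isComplete d T }.

#[short(type="completeMonadicOrtholatticeType")]
HB.structure Definition CompleteMonadicOrtholattice d :=
  { T of MonadicOrtholattice d T & TBLattice_isComplete d T }.

Section Orthoframes.
Variables (X : Type) (perp : X -> X -> Prop) (R : X -> X -> Prop).

Definition orth (S : set X) : set X := [set y | forall x, S x -> perp x y].

Definition relimage (A : set X) : set X := [set y | exists2 x, A x & R x y].

Definition is_orthoframe : Prop :=
  (forall x, ~ perp x x) /\ (forall x y, perp x y -> perp y x).

Definition is_monadic_orthoframe : Prop :=
  [/\ is_orthoframe,
      forall x, R x x,
      forall x y z, R x y -> R y z -> R x z &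
      forall x, relimage (orth (relimage [set x])) `<=` orth (relimage [set x])].

End Orthoframes.

Record orthoframe := Orthoframe {
  of_sort :> Type;
  of_perp : of_sort -> of_sort -> Prop;
  of_axiom : is_orthoframe of_perp
}.

Record monadicOrthoframe := MonadicOrthoframe {
  mof_sort : Type;
  mof_perp : mof_sort -> mof_sort -> Prop;
  mof_rel : mof_sort -> mof_sort -> Prop;
  mof_axiom : is_monadic_orthoframe mof_perp mof_rel
}.

Lemma mof_orthoframe_axiom (X : monadicOrthoframe) :
  is_orthoframe (@mof_perp X).
Proof. by case: X => T p r []. Qed.

Coercion mof_orthoframe (X : monadicOrthoframe) : orthoframe :=
  Orthoframe (mof_orthoframe_axiom X).

Section Bclosed.
Variable X : orthoframe.
Implicit Types (S : set X).
Local Notation orth := (orth (@of_perp X)).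

(* The bi-orthogonally closed subsets of X, i.e. the ortholattice B(X). *)
Record bclosed := Bclosed {
  bset :> set X;
  bsetP : bset = orth (orth bset)
}.

Lemma bset_inj : injective bset.
Proof.
move=> [A hA] [B hB] /= eAB; subst B; congr Bclosed; exact: Prop_irrelevance.
Qed.

Lemma perpC x y : @of_perp X x y -> of_perp y x.
Proof. by case: (of_axiom X) => _; apply. Qed.

Lemma orthS S S' : S `<=` S' -> orth S' `<=` orth S.
Proof. by move=> sSS y h x /sSS; apply: h. Qed.

Lemma sub_orthK S : S `<=` orth (orth S).
Proof. by move=> x Sx y h; apply: perpC; apply: h. Qed.

Lemma orth3 S : orth S = orth (orth (orth S)).
Proof.
apply/seteqP; split; first exact: sub_orthK.
by apply: orthS; apply: sub_orthK.
Qed.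

Definition borth S : bclosed := Bclosed (orth3 S).

Definition bclosure S : bclosed := borth (orth S).

Lemma bclosure_sub S (B : bclosed) : S `<=` B -> bclosure S `<=` B.
Proof. by move=> sSB; rewrite [bset B]bsetP; apply: orthS; apply: orthS. Qed.

Lemma binter_subproof (F : set bclosed) :
  \bigcap_(B in F) B = orth (orth (\bigcap_(B in F) B)).
Proof.
apply/seteqP; split; first exact: sub_orthK.
move=> x hx B FB; apply: (@bclosure_sub (\bigcap_(B in F) B)) hx.
by move=> y; apply.
Qed.

Definition binter (F : set bclosed) : bclosed := Bclosed (binter_subproof F).

Lemma binter2_subproof (A B : bclosed) :
  (A `&` B)%classic = orth (orth (A `&` B)%classic).
Proof.
apply/seteqP; split; first exact: sub_orthK.
by move=> x hx; split; apply: bclosure_sub hx => y [].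
Qed.

Definition binter2 (A B : bclosed) : bclosed := Bclosed (binter2_subproof A B).

HB.instance Definition _ := gen_eqMixin bclosed.
HB.instance Definition _ := gen_choiceMixin bclosed.

Definition ble (A B : bclosed) : bool := `[< bset A `<=` bset B >].

Lemma ble_refl : reflexive ble.
Proof. by move=> A; apply/asboolP. Qed.

Lemma ble_anti : antisymmetric ble.
Proof.
by move=> A B /andP[/asboolP h1 /asboolP h2]; apply/bset_inj/seteqP.
Qed.

Lemma ble_trans : transitive ble.
Proof.
by move=> B A C /asboolP h1 /asboolP h2; apply/asboolP/(subset_trans h1).
Qed.

HB.instance Definition _ := @Order.Le_isPOrder.Build set_display bclosed
  ble ble_refl ble_anti ble_trans.

Lemma bleP (A B : bclosed) : reflect (bset A `<=` bset B) (A <= B).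
Proof. exact: asboolP. Qed.

Lemma bmeetP (A B C : bclosed) : (A <= binter2 B C) = (A <= B) && (A <= C).
Proof.
apply/bleP/andP => [h|[/bleP h1 /bleP h2] x Ax]; last by split; auto.
by split; apply/bleP => x /h [].
Qed.

Lemma bjoinP (A B C : bclosed) :
  (bclosure (bset A `|` bset B)%classic <= C) = (A <= C) && (B <= C).
Proof.
apply/bleP/andP => [h|[/bleP h1 /bleP h2]].
  by split; apply/bleP => x Ax; apply: h; apply: sub_orthK; [left|right].
by apply: bclosure_sub => x [/h1|/h2].
Qed.

HB.instance Definition _ := @Order.POrder_MeetJoin_isLattice.Build
  set_display bclosed binter2 (fun A B => bclosure (bset A `|` bset B)%classic)
  bmeetP bjoinP.

Lemma ble0 (A : bclosed) : bclosure set0 <= A.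
Proof. by apply/bleP; apply: bclosure_sub. Qed.

Lemma ble1 (A : bclosed) : A <= borth set0.
Proof. by apply/bleP => x _ y []. Qed.

HB.instance Definition _ :=
  @Order.hasBottom.Build set_display bclosed (bclosure set0) ble0.
HB.instance Definition _ :=
  @Order.hasTop.Build set_display bclosed (borth set0) ble1.

Lemma binterP (F : set bclosed) : infimums F (binter F).
Proof.
split=> [A FA|A hA]; first by apply/bleP => x; apply.
by apply/bleP => x Ax B FB; move/bleP: (hA B FB); apply.
Qed.

Lemma bunionP (F : set bclosed) :
  supremums F (bclosure (\bigcup_(B in F) B)).
Proof.
split=> [A FA|A hA]; first by apply/bleP => x Ax; apply: sub_orthK; exists A.
by apply/bleP; apply: bclosure_sub => x [B FB Bx]; move/bleP: (hA B FB); apply.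
Qed.

HB.instance Definition _ := @TBLattice_isComplete.Build set_display bclosed
  binter (fun F => bclosure (\bigcup_(B in F) B)) binterP bunionP.

Lemma borthI (A : bclosed) : Order.meet A (borth A) = \bot.
Proof.
apply/le_anti; rewrite le0x andbT; apply/bleP => x [Ax /(_ x Ax) xx].
by case: (of_axiom X) => /(_ x xx).
Qed.

Lemma borth_le (A B : bclosed) : A <= B -> borth B <= borth A.
Proof. by move=> /bleP h; apply/bleP; apply: orthS. Qed.

Lemma borthK (A : bclosed) : borth (borth A) = A.
Proof. by apply/bset_inj; rewrite /= -bsetP. Qed.

Lemma borthU (A : bclosed) : Order.join A (borth A) = \top.
Proof.
apply/le_anti; rewrite lex1 /=; apply/bleP => x _.
change (orth (orth (bset A `|` bset (borth A))%classic) x) => y hy; exfalso.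
have hA : bset (borth A) y by move=> z Az; apply: hy; left.
by case: (of_axiom X) => /(_ y) + _; apply; apply: hy; right.
Qed.

HB.instance Definition _ := @TBLattice_isOrtholattice.Build set_display bclosed
  borth borthI borthU borth_le borthK.

End Bclosed.

Section MonadicBclosed.
Variable X : monadicOrthoframe.
Local Notation orth := (orth (@mof_perp X)).
Local Notation R := (@mof_rel X).

Definition bexq (A : bclosed X) : bclosed X := bclosure (X := X) (relimage R A).

Lemma relimage_ge (A : set X) : A `<=` relimage R A.
Proof. by case: X A => T p r [/= _ rr _ _] A x Ax; exists x. Qed.

Lemma relimage_orth1 (x y z : X) : orth (relimage R [set x]) y -> R y z ->
  orth (relimage R [set x]) z.
Proof.
case: X x y z => T p r [/= _ _ _ h] x y z hy yz; apply: (h x); by exists y.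
Qed.

Lemma relimage_orth (A : set X) (y z : X) :
  orth (relimage R A) y -> R y z -> orth (relimage R A) z.
Proof.
move=> hy yz w [x Ax xw]; have /(@relimage_orth1 x) h : orth (relimage R [set x]) y.
  by move=> u [_ -> xu]; apply: hy; exists x.
by apply: (h z yz); exists x.
Qed.

Lemma relimage_orth2 (A : set X) (y z : X) :
  orth (orth (relimage R A)) y -> R y z -> orth (orth (relimage R A)) z.
Proof.
move=> hy yz w hw.
have /(@relimage_orth1 w) h : orth (relimage R [set w]) y.
  by move=> u [_ -> wu]; apply: hy; apply: relimage_orth hw wu.
by apply: (h z yz); apply: relimage_ge.
Qed.

Lemma bexq_le (A B : bclosed X) : A <= B -> bexq A <= bexq B.
Proof.
move=> /bleP h; apply/bleP; do 2 apply: (@orthS X).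
by move=> y [x /h Bx xy]; exists x.
Qed.

Lemma bexq_ge (A : bclosed X) : A <= bexq A.
Proof. by apply/bleP => x Ax; apply: (@sub_orthK X); apply: relimage_ge. Qed.

Lemma bexqK (A : bclosed X) : bexq (bexq A) = bexq A.
Proof.
apply/le_anti; rewrite bexq_ge andbT; apply/bleP.
by apply: bclosure_sub => z [y hy yz]; apply: relimage_orth2 hy yz.
Qed.

Lemma bexq_ocompl (A : bclosed X) :
  bexq A = A -> bexq (ocompl A) = ocompl A.
Proof.
move=> eA; apply/le_anti; rewrite bexq_ge andbT; apply/bleP.
apply: bclosure_sub => z [y hy yz].
have e : bset (ocompl A) = orth (relimage R A).
  by rewrite -[in LHS]eA /= -(@orth3 X).
by rewrite e; apply: relimage_orth yz; rewrite -e.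
Qed.

HB.instance Definition _ := @Ortholattice_isMonadic.Build set_display
  (bclosed X) bexq bexq_le bexq_ge bexqK bexq_ocompl.

End MonadicBclosed.

Section CanonicalCompletion.
Context {dL dC : Order.disp_t}.

Definition lattice_embedding (L : tbLatticeType dL) (C : tbLatticeType dC)
    (e : L -> C) : Prop :=
  [/\ injective e, Order.meet_morphism e, Order.join_morphism e,
      e \bot = \bot & e \top = \top].

(* [dense_map], [compact_map] and [closed_elements] only involve the image of
   [e], so no structure on [L] is needed; finite subsets may be empty. *)
Definition dense_map (L : Type) (C : completeLatticeType dC) (e : L -> C) : Prop :=
  forall x : C,
    (exists F : set (set L), x = bigjoin [set bigmeet (e @` S) | S in F]) /\
    (exists F : set (set L), x = bigmeet [set bigjoin (e @` S) | S in F]).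

Definition compact_map (L : Type) (C : completeLatticeType dC) (e : L -> C) : Prop :=
  forall S T : set L, bigmeet (e @` S) <= bigjoin (e @` T) ->
    exists S' T' : set L,
      [/\ finite_set S', S' `<=` S, finite_set T', T' `<=` T &
          bigmeet (e @` S') <= bigjoin (e @` T')].

Definition is_canonical_completion (L : tbLatticeType dL)
    (C : completeLatticeType dC) (e : L -> C) : Prop :=
  [/\ lattice_embedding e, dense_map e & compact_map e].

Definition closed_elements (L : Type) (C : completeLatticeType dC) (e : L -> C) :
    set C :=
  [set k | exists S : set L, k = bigmeet (e @` S)].

Definition ocompl_sigma (L : ortholatticeType dL) (C : completeLatticeType dC)
    (e : L -> C) (x : C) : C :=
  bigmeet [set bigjoin [set e (ocompl a) | a in [set a | k <= e a]]
          | k in [set k | closed_elements e k /\ k <= x]].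

Definition exq_sigma (L : monadicOrtholatticeType dL)
    (C : completeLatticeType dC) (e : L -> C) (x : C) : C :=
  bigjoin [set bigmeet [set e (exq a) | a in [set a | k <= e a]]
          | k in [set k | closed_elements e k /\ k <= x]].

Definition is_monadic_canonical_completion (L : monadicOrtholatticeType dL)
    (C : completeMonadicOrtholatticeType dC) (e : L -> C) : Prop :=
  [/\ is_canonical_completion e,
      forall x : C, ocompl x = ocompl_sigma e x &
      forall x : C, exq x = exq_sigma e x].

End CanonicalCompletion.

Section Filters.
Context {d : Order.disp_t}.

Record properFilter (L : tbLatticeType d) := ProperFilter {
  pf_set :> set L;
  pf_nonempty : pf_set !=set0;
  pf_proper : pf_set <> setT;
  pf_up : forall a b : L, pf_set a -> a <= b -> pf_set b;
  pf_meet : forall a b : L, pf_set a -> pf_set b -> pf_set (Order.meet a b)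
}.

Definition pf_perp (L : ortholatticeType d) (x y : properFilter L) : Prop :=
  exists a : L, [/\ a <> \bot, pf_set x a & pf_set y (ocompl a)].

Definition pf_rel (L : monadicOrtholatticeType d) (x y : properFilter L) : Prop :=
  exq @` pf_set x `<=` pf_set y.

End Filters.

(* Main.v *)
Require Import Defs.
From HB Require Import structures.
From mathcomp Require Import all_boot all_order.
From mathcomp Require Import boolp classical_sets cardinality.

(** A proper filter [x] plays the role of the closed element it generates, and
everything rests on three descriptions of subsets of the frame.

- [orth_stone]: the filters containing [a] are exactly those orthogonal to all
  filters containing [ocompl a], because the principal filter of [ocompl a] is
  one of the latter. So these sets are bi-orthogonally closed, and the map
  [stone] sending [a] to the set of filters containing [a] preserves the
  orthocomplement. It visibly preserves meets, hence, by De Morgan, joins; it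
  reflects the order because of principal filters.
- [bigmeet_stoneP]: the meet of the images of the members of [x] is the set of
  filters extending [x]. A bi-orthogonally closed set is closed under extension
  of filters, so it is the union of such sets: this is the first half of
  density.
- [bigjoin_stone_ocomplP]: the join of the images of the complements of the
  members of [x] is the set of filters orthogonal to [x]. Since [A] is the
  intersection of the sets orthogonal to the points of its orthocomplement, this
  is the second half of density.

For compactness, suppose that the meet of the images of [S] lies below the join
of the images of [T]. Let [F] be the filter generated by [S] and [G] the set of
complements of the ideal generated by [T]. If both are proper, then [F] is a
point of the meet, hence of the join, while [G] is orthogonal to every filter
that meets [T]; so [G] is orthogonal to [F], and the element witnessing this
lies above a finite meet from [S] and below a finite join from [T]. If one of
them is improper, a bound of [L] is such an element.

That the orthocomplement is its own extension is a fact about every dense map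
that preserves complements ([ocompl_sigmaE]). For the quantifier, [R] relates
[x] to the filters containing [exq a] for all [a] in [x]; these are the points
of the meet of the images of the [exq a], which is the term of the extension
indexed by the closed element of [x] ([stone_exq]). *)

Import Order.TTheory.
Local Open Scope classical_set_scope.
Local Open Scope order_scope.

(** * Ortholattices and complete lattices *)

Section OrtholatticeTheory.
Context {d : Order.disp_t} {L : ortholatticeType d}.
Implicit Types a b : L.

Lemma ocompl_leC a b : (ocompl a <= b) = (ocompl b <= a).
Proof. by apply/idP/idP => /ocompl_le; rewrite ocomplK. Qed.

Lemma le_ocomplC a b : (a <= ocompl b) = (b <= ocompl a).
Proof. by apply/idP/idP => /ocompl_le; rewrite ocomplK. Qed.

Lemma ocompl_join a b :
  ocompl (Order.join a b) = Order.meet (ocompl a) (ocompl b).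
Proof.
apply/le_anti; rewrite lexI !ocompl_le ?leUl ?leUr //=.
by rewrite le_ocomplC leUx -!(le_ocomplC (_ `&` _)) leIl leIr.
Qed.

Lemma ocompl_meet a b :
  ocompl (Order.meet a b) = Order.join (ocompl a) (ocompl b).
Proof. by rewrite -[RHS]ocomplK ocompl_join !ocomplK. Qed.

Lemma ocompl0 : ocompl (\bot : L) = \top.
Proof. by apply/le_anti; rewrite lex1 le_ocomplC le0x. Qed.

Lemma ocompl1 : ocompl (\top : L) = \bot.
Proof. by rewrite -ocompl0 ocomplK. Qed.

End OrtholatticeTheory.

Lemma exq0 {d : Order.disp_t} {L : monadicOrtholatticeType d} :
  exq (\bot : L) = \bot.
Proof.
rewrite -ocompl1; apply: exq_ocompl.
by apply/le_anti; rewrite lex1 exq_ge.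
Qed.

Section CompleteLatticeTheory.
Context {d : Order.disp_t} {C : completeLatticeType d}.
Implicit Types (A : set C) (c : C).

Lemma bigmeet_lb A c : A c -> bigmeet A <= c.
Proof. by case: (bigmeetP A) => + _; apply. Qed.

Lemma bigmeet_glb A c : (forall x, A x -> c <= x) -> c <= bigmeet A.
Proof. by case: (bigmeetP A) => _; apply. Qed.

Lemma bigjoin_ub A c : A c -> c <= bigjoin A.
Proof. by case: (bigjoinP A) => + _; apply. Qed.

Lemma bigjoin_lub A c : (forall x, A x -> x <= c) -> bigjoin A <= c.
Proof. by case: (bigjoinP A) => _; apply. Qed.

End CompleteLatticeTheory.

(** Complementation is an order-reversing involution, so it turns joins into
meets and agrees with its extension at closed elements. Every [x] is the join of
the closed elements below it, so [ocompl x] is the meet of their complements. *)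
Lemma ocompl_sigmaE {dL dC : Order.disp_t} {L : ortholatticeType dL}
    {C : completeOrtholatticeType dC} (e : L -> C) :
  {morph e : a / ocompl a} -> dense_map e ->
  forall x : C, ocompl x = ocompl_sigma e x.
Proof.
move=> eN eD x; apply/le_anti/andP; split.
  apply: bigmeet_glb => _ [_ [[S ->]] kx <-].
  apply: le_trans (ocompl_le _ _ kx) _.
  rewrite ocompl_leC; apply: bigmeet_glb => _ [s Ss <-].
  rewrite ocompl_leC -eN; apply: bigjoin_ub; exists s => //.
  by apply: bigmeet_lb; exists s.
rewrite le_ocomplC.
have [[F xE] _] := eD x; rewrite {1}xE; apply: bigjoin_lub => _ [S FS <-].
rewrite le_ocomplC; set k := bigmeet _.
have kx : k <= x by rewrite xE; apply: bigjoin_ub; exists S.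
apply: (@le_trans _ _ (bigjoin [set e (ocompl a) | a in [set a | k <= e a]])).
  by apply: bigmeet_lb; exists k => //; split => //; exists S.
by apply: bigjoin_lub => _ [a ka <-]; rewrite eN; apply: ocompl_le.
Qed.

(** * Proper filters *)

Section ProperFilters.
Context {d : Order.disp_t} {L : tbLatticeType d}.
Implicit Types (x y : properFilter L) (a b : L) (P : set L).

Lemma pf_bot x : ~ pf_set x \bot.
Proof.
move=> x0; case: (@pf_proper _ _ x); rewrite -subTset => a _.
exact: pf_up x0 (le0x a).
Qed.

Lemma pf_top x : pf_set x \top.
Proof. by have [a xa] := pf_nonempty x; apply: pf_up xa (lex1 a). Qed.

Lemma exists_filter P : P \top -> ~ P \bot ->
  (forall a b, P a -> a <= b -> P b) ->
  (forall a b, P a -> P b -> P (Order.meet a b)) ->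
  exists x, pf_set x = P.
Proof.
move=> P1 P0 Pup PI.
have P_proper : P <> setT by move=> PT; apply: P0; rewrite PT.
by exists (@ProperFilter _ _ P (ex_intro _ _ P1) P_proper Pup PI).
Qed.

Lemma exists_principal a : a <> \bot ->
  exists x, forall b, pf_set x b <-> a <= b.
Proof.
move=> a0; case: (@exists_filter [set b | a <= b]) => [||b c|b c ab ac|x xE] /=.
- exact: lex1.
- by move=> a_le0; apply: a0; apply/le_anti; rewrite a_le0 le0x.
- exact: le_trans.
- by rewrite lexI ab ac.
- by exists x => b; rewrite xE.
Qed.

End ProperFilters.

(** * The orthoframe of proper filters *)

Section FilterFrame.
Context {d : Order.disp_t} {L : ortholatticeType d}.
Implicit Types (x y : properFilter L) (a b : L).

(** The non-zero condition in the orthogonality relation is automatic, as the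
witness lies in a proper filter. *)
Lemma pf_perpP x y :
  pf_perp x y <-> exists2 a, pf_set x a & pf_set y (ocompl a).
Proof.
split=> [[a [_ xa ya]]|[a xa ya]]; first by exists a.
by exists a; split=> // a0; apply: (@pf_bot _ _ x); rewrite -a0.
Qed.

Lemma pf_perp_irr x : ~ pf_perp x x.
Proof.
move=> /pf_perpP[a xa xNa]; apply: (@pf_bot _ _ x).
by rewrite -(ocomplI a); apply: pf_meet.
Qed.

Lemma pf_perp_sym x y : pf_perp x y -> pf_perp y x.
Proof.
move=> /pf_perpP[a xa ya]; apply/pf_perpP.
by exists (ocompl a); rewrite ?ocomplK.
Qed.

Lemma pf_perp_up x y y' :
  pf_set y `<=` pf_set y' -> pf_perp x y -> pf_perp x y'.
Proof.
by move=> yy' /pf_perpP[a xa /yy' y'a]; apply/pf_perpP; exists a.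
Qed.

(** A filter [y] orthogonal to the principal filter of [ocompl a] contains the
complement of some element above [ocompl a], and therefore contains [a]. The
principal filter is improper when [ocompl a] is zero, but then [a] is the top
and lies in every filter. *)
Lemma orth_stone a :
  orth (@pf_perp d L) [set x | pf_set x (ocompl a)] = [set x | pf_set x a].
Proof.
apply/seteqP; split=> [y hy|y ya x xNa] /=; last first.
  by apply: pf_perp_sym; apply/pf_perpP; exists a.
have [Na0|/exists_principal[x xE]] := pselect (ocompl a = \bot).
  by rewrite -[a]ocomplK Na0 ocompl0; apply: pf_top.
have /pf_perpP[b /xE Nab yb] : pf_perp x y by apply: hy; apply/xE.
by apply: pf_up yb _; rewrite ocompl_leC.
Qed.

End FilterFrame.

(** * The accessibility relation on filters *)

Section MonadicFilterFrame.
Context {d : Order.disp_t} {L : monadicOrtholatticeType d}.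
Implicit Types (x y : properFilter L) (a b : L).

(** The filter generated by the closures of the members of [x] is proper because
the quantifier is inflationary. As the smallest filter accessible from [x], it
turns orthogonality to all successors of [x] into a statement about members
of [x]. *)
Lemma exists_least_successor x :
  exists y, forall b, pf_set y b <-> exists2 a, pf_set x a & exq a <= b.
Proof.
case: (@exists_filter _ L [set b | exists2 a, pf_set x a & exq a <= b]).
- by exists \top; [apply: pf_top|apply: lex1].
- move=> [a xa]; rewrite lex0 => /eqP a0; apply: (@pf_bot _ _ x).
  by apply: pf_up xa _; rewrite -a0 exq_ge.
- by move=> b c [a xa ab] bc; exists a => //; apply: le_trans bc.
- move=> b c [a1 xa1 ab] [a2 xa2 ac]; exists (Order.meet a1 a2).
    exact: pf_meet.
  rewrite lexI (le_trans _ ab) ?(le_trans _ ac) //; apply: exq_le.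
    exact: leIr.
  exact: leIl.
- by move=> y yE; exists y => b; rewrite yE.
Qed.

(** For the last axiom, if [y] is orthogonal to the successors of [x], then it is
orthogonal to the least one, so [ocompl (exq a)] is in [y] for some [a] in [x].
That complement is closed, so it passes to every successor [z] of [y], whereas
[exq a] belongs to every successor of [x]. *)
Lemma pf_monadic_orthoframe : is_monadic_orthoframe (@pf_perp d L) (@pf_rel d L).
Proof.
split.
- by split; [apply: pf_perp_irr|apply: pf_perp_sym].
- by move=> x _ [a xa <-]; apply: pf_up xa (exq_ge a).
- move=> x y z xy yz _ [a xa <-]; rewrite -exqK.
  by apply: yz; exists (exq a) => //; apply: xy; exists a.
move=> x z [y xy yz] w [_ -> xw].
have [u uE] := exists_least_successor x.
have xu : pf_rel x u by move=> _ [a xa <-]; apply/uE; exists a.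
have /pf_perpP[b /uE[a xa ab] yb] : pf_perp u y by apply: xy; exists x.
apply/pf_perpP; exists (exq a); first by apply: xw; exists a.
rewrite -(exq_ocompl _ (exqK a)); apply: yz; exists (ocompl (exq a)) => //.
by apply: pf_up yb _; apply: ocompl_le.
Qed.

End MonadicFilterFrame.

(** * The embedding into bi-orthogonally closed sets *)

Section StoneMap.
Context {d : Order.disp_t} {L : monadicOrtholatticeType d}.

Let X := MonadicOrthoframe (@pf_monadic_orthoframe d L).
Implicit Types (x y : properFilter L) (a b : L) (S T : set L) (A B : bclosed X).

(** Orthogonals are closed by construction, so the set of filters containing [a]
is obtained here as the orthogonal of the set belonging to [ocompl a]. *)
Definition stone a : bclosed X :=
  borth (X := X) [set x : properFilter L | pf_set x (ocompl a)].

Lemma stoneE a : bset (stone a) = [set x : properFilter L | pf_set x a].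
Proof. exact: orth_stone. Qed.

Lemma stoneP a x : bset (stone a) x <-> pf_set x a.
Proof. by rewrite stoneE. Qed.

Lemma stone_le a b : (stone a <= stone b) = (a <= b).
Proof.
apply/bleP/idP => [ab|ab x /stoneP xa]; last by apply/stoneP; apply: pf_up xa ab.
have [->|/exists_principal[x xE]] := pselect (a = \bot); first exact: le0x.
by apply/xE/stoneP/ab/stoneP/xE.
Qed.

Lemma stone_meet : Order.meet_morphism stone.
Proof.
move=> a b; apply/bset_inj; rewrite stoneE.
change ([set x : properFilter L | pf_set x (Order.meet a b)]
  = (bset (stone a) `&` bset (stone b))%classic).
rewrite !stoneE; apply/seteqP; split=> x /= => [xab|[]]; last exact: pf_meet.
by split; apply: pf_up xab _; [apply: leIl|apply: leIr].
Qed.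

Lemma stone_ocompl : {morph stone : a / ocompl a}.
Proof.
move=> a; apply/bset_inj.
change (bset (stone (ocompl a)) = orth (@pf_perp d L) (bset (stone a))).
by rewrite !stoneE -orth_stone ocomplK.
Qed.

Lemma stone_join : Order.join_morphism stone.
Proof.
move=> a b.
by rewrite -[LHS]ocomplK -stone_ocompl ocompl_join stone_meet !stone_ocompl
  ocompl_meet !ocomplK.
Qed.

Lemma stone0 : stone \bot = \bot.
Proof.
apply/le_anti; rewrite le0x andbT; apply/bleP => x /stoneP x0.
by case: (@pf_bot _ _ x).
Qed.

Lemma stone1 : stone \top = \top.
Proof. by rewrite -ocompl0 stone_ocompl stone0 ocompl0. Qed.

Lemma stone_embedding : lattice_embedding stone.
Proof.
split; [|exact: stone_meet|exact: stone_join|exact: stone0|exact: stone1].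
by move=> a b ab; apply/le_anti; rewrite -!stone_le ab lexx.
Qed.

(** * Density *)

Lemma bigmeet_stoneP S x : bset (bigmeet (stone @` S)) x <-> S `<=` pf_set x.
Proof.
split=> [xS s Ss|Sx _ [s Ss <-]]; last by apply/stoneP/Sx.
by apply/stoneP; apply: xS; exists s.
Qed.

(** Extending a filter preserves what it is orthogonal to, and a closed set is an
orthogonal. *)
Lemma bclosed_up A x y : bset A x -> pf_set x `<=` pf_set y -> bset A y.
Proof.
rewrite (bsetP A) => Ax xy z Az; apply: (@pf_perp_up d L z x y) => //.
exact: Ax.
Qed.

Lemma bigmeet_stone_le A x : bset A x -> bigmeet (stone @` pf_set x) <= A.
Proof.
by move=> Ax; apply/bleP => y /bigmeet_stoneP; apply: bclosed_up Ax.
Qed.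

Lemma bigjoin_stone_ocomplP x y :
  bset (bigjoin (stone @` (ocompl @` pf_set x))) y <-> pf_perp x y.
Proof.
split=> [|/pf_perpP[a xa ya]].
  have /bleP le_orthx : bigjoin (stone @` (ocompl @` pf_set x))
      <= borth (X := X) [set x].
    apply: bigjoin_lub => _ [_ [a xa <-] <-]; apply/bleP => z /stoneP za _ ->.
    by apply/pf_perpP; exists a.
  by move=> /le_orthx; apply.
have /bleP le_join :
    stone (ocompl a) <= bigjoin (stone @` (ocompl @` pf_set x)).
  by apply: bigjoin_ub; exists (ocompl a) => //; exists a.
exact/le_join/stoneP.
Qed.

Lemma stone_dense : dense_map stone.
Proof.
move=> A; split.
  exists [set pf_set x | x in bset A]; apply/le_anti/andP; split; last first.
    by apply: bigjoin_lub => _ [_ [x Ax <-] <-]; apply: bigmeet_stone_le.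
  apply/bleP => x Ax.
  have/bleP : bigmeet (stone @` pf_set x)
      <= bigjoin [set bigmeet (stone @` S) | S in [set pf_set x | x in bset A]].
    by apply: bigjoin_ub; exists (pf_set x) => //; exists x.
  by apply; apply/bigmeet_stoneP.
(* [A] is the intersection of the orthogonals of the points of [ocompl A]. *)
exists [set ocompl @` pf_set x | x in bset (ocompl A)].
apply/le_anti/andP; split; apply/bleP => y.
  move=> Ay _ [_ [x Ax <-] <-]; apply/bigjoin_stone_ocomplP.
  by apply: pf_perp_sym; apply: Ax.
move=> yF; rewrite (bsetP A) => x Ax; apply/bigjoin_stone_ocomplP; apply: yF.
by exists (ocompl @` pf_set x) => //; exists x.
Qed.

(** * Compactness *)

(** The filter generated by [S]. The meet of a finite subset is taken after
mapping to the completion, where meets of arbitrary sets exist, so that the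
finite subsets need not be enumerated; as [stone] is an embedding, this gives
the same filter. *)
Definition finmeet_filter S : set L :=
  [set a | exists S', [/\ finite_set S', S' `<=` S &
                          bigmeet (stone @` S') <= stone a]].

(** The complements of the members of the ideal generated by [T]; passing to
complements makes it a filter, hence possibly a point of the frame. *)
Definition finjoin_filter T : set L :=
  [set a | exists T', [/\ finite_set T', T' `<=` T &
                          stone (ocompl a) <= bigjoin (stone @` T')]].

(** It suffices to interpolate an element between a finite meet from [S] and a
finite join from [T], that is, to find [c] in the filter of [S] whose complement
is in the filter of [T]. *)
Lemma stone_compact : compact_map stone.
Proof.
move=> S T ST.
set F := finmeet_filter S; set G := finjoin_filter T.
suff [c [S' [finS' S'S S'c]] [T' [finT' T'T cT']]] :
    exists2 c, F c & G (ocompl c).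
  exists S', T'; split=> //; apply: le_trans S'c _.
  by rewrite -{1}[c]ocomplK.
have F1 : F \top.
  by exists set0; split=> //; rewrite stone1 lex1.
have G1 : G \top.
  by exists set0; split=> //; rewrite ocompl1 stone0 le0x.
have [F0|F0] := pselect (F \bot); first by exists \bot; rewrite ?ocompl0.
have [G0|G0] := pselect (G \bot); first by exists \top; rewrite ?ocompl1.
have [|||a b|x xE] := @exists_filter _ L F => //.
- move=> a b [S' [finS' S'S S'a]] ab; exists S'; split=> //.
  by apply: le_trans S'a _; rewrite stone_le.
- move=> [S1 [finS1 S1S S1a]] [S2 [finS2 S2S S2b]].
  exists (S1 `|` S2)%classic; split; [by rewrite finite_setU|by move=> s [/S1S|/S2S]|].
  rewrite stone_meet lexI (le_trans _ S1a) ?(le_trans _ S2b) //;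
    apply: bigmeet_glb => _ [s S's <-]; apply: bigmeet_lb; exists s => //.
    by right.
  by left.
have [|||a b|y yE] := @exists_filter _ L G => //.
- move=> a b [T' [finT' T'T aT']] ab; exists T'; split=> //.
  by apply: le_trans aT'; rewrite stone_le ocompl_le.
- move=> [T1 [finT1 T1T aT1]] [T2 [finT2 T2T bT2]].
  exists (T1 `|` T2)%classic; split; [by rewrite finite_setU|by move=> s [/T1T|/T2T]|].
  rewrite ocompl_meet stone_join leUx (le_trans aT1) ?(le_trans bT2) //;
    apply: bigjoin_lub => _ [s T's <-]; apply: bigjoin_ub; exists s => //.
    by right.
  by left.
(* The filter [x] is a point of the meet over [S], hence of the join over [T],
   which is the bi-orthogonal of the union of the images of [T]; so it is enough
   that [y] is orthogonal to every filter that meets [T]. *)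
suff /pf_perpP[c] : pf_perp x y by rewrite xE yE; exists c.
have xS : bset (bigmeet (stone @` S)) x.
  apply/bigmeet_stoneP => s Ss; rewrite xE; exists [set s]; split=> //.
    by move=> _ ->.
  by apply: bigmeet_lb; exists s.
have /bleP/(_ x xS) xT := ST; apply: pf_perp_sym; apply: (xT y).
move=> z [_ [t Tt <-] /stoneP zt]; apply/pf_perpP; exists t => //.
rewrite yE; exists [set t]; rewrite ocomplK; split=> //; first by move=> _ ->.
by apply: bigjoin_ub; exists t.
Qed.

(** * The quantifier *)

(** The right-hand side is bi-orthogonally closed, so for the first inequality
it is enough to treat the points of the relational image of [A]. Conversely, a
non-zero closed [k] below [A] corresponds to the proper filter of all [a] with
[k] below [stone a]: this filter is a point of [A], and the term of [k] consists
of its successors. *)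
Lemma stone_exq A : exq A = exq_sigma stone A.
Proof.
apply/le_anti/andP; split.
  apply/bleP; apply: bclosure_sub => y [x Ax xy].
  set k := bigmeet (stone @` pf_set x).
  have/bleP : bigmeet [set stone (exq a) | a in [set a | k <= stone a]]
      <= exq_sigma stone A.
    apply: bigjoin_ub; exists k => //; split; first by exists (pf_set x).
    exact: bigmeet_stone_le.
  apply=> _ [a /bleP ka <-]; apply/stoneP; apply: xy; exists a => //.
  by apply/stoneP; apply: ka; apply/bigmeet_stoneP.
apply: bigjoin_lub => _ [k [[S kE] kA] <-].
set M := bigmeet _.
(* For [k] zero there is no such filter, but the term of [k] vanishes because
   [exq] fixes zero. *)
have [k0|k0] := pselect (k <= stone \bot).
  apply: (@le_trans _ _ (stone (exq \bot))); last by rewrite exq0 stone0 le0x.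
  by apply: bigmeet_lb; exists \bot.
have [||a b ka ab|a b ka kb|x xE] := @exists_filter _ L [set a | k <= stone a].
- by rewrite /= stone1 lex1.
- exact: k0.
- by apply: le_trans ka _; rewrite stone_le.
- by rewrite /= stone_meet lexI ka kb.
apply/bleP => y My; apply: (@sub_orthK X); exists x.
  have /bleP := kA; apply; rewrite kE; apply/bigmeet_stoneP => s Ss.
  by rewrite xE /= kE; apply: bigmeet_lb; exists s.
by move=> _ [a xa <-]; apply/stoneP; apply: My; exists a => //; rewrite xE in xa.
Qed.

End StoneMap.

Theorem proposition3p5 (d : Order.disp_t) (L : monadicOrtholatticeType d) :
  exists HX : is_monadic_orthoframe (@pf_perp d L) (@pf_rel d L),
  exists h : L -> bclosed (MonadicOrthoframe HX),
    (forall a : L, bset (h a) = [set x : properFilter L | pf_set x a]) /\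
    is_monadic_canonical_completion h.
Proof.
exists pf_monadic_orthoframe, stone; split; first exact: stoneE.
split; last exact: stone_exq.
  by split; [apply: stone_embedding|apply: stone_dense|apply: stone_compact].
exact: (ocompl_sigmaE _ stone_ocompl stone_dense).
Qed.
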